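(* For any composition $I$, in $\mathcal NSym$ we have $$\Xi^I=\sum_{L\succeq I}c_{I,L}\,\Psi^L,\qquad \Psi^I=\sum_{L\succeq I}c_{\bar I,\bar L}\,\Xi^L,$$ where, for any compositions $L\succeq I$, $$c_{I,L}:=\sum_{L\succeq J\succeq I}(-1)^{\ell(J)-\ell(I)}\frac{fp(J,I)}{\pi_u(L,J)}.$$ Here $J$ and $L$ range over compositions.
   Context: $K$ is a unital commutative $\mathbb Q$-algebra and $t$ a central formal parameter. $\mathcal NSym$ is the free unital associative $K$-algebra on noncommuting variables $\Lambda_m$ ($m\ge1$), $\Lambda_0=1$, $\lambda(t)=\sum_{m\ge0}t^m\Lambda_m$. Elements $S_m,\Psi_m,\Xi_m$ of $\mathcal NSym$ are defined by $\sigma(t)=\sum_{m\ge0}t^mS_m$, $\psi(t)=\sum_{m\ge1}t^{m-1}\Psi_m$, $\xi(t)=\sum_{m\ge1}t^{m-1}\Xi_m$, the unique solutions in $\mathcal NSym[[t]]$ of $\lambda(-t)\sigma(t)=\sigma(t)\lambda(-t)=1$, $\frac{d\sigma(t)}{dt}=\sigma(t)\psi(t)=\xi(t)\sigma(t)$. A composition is a nonempty finite sequence $I=(i_1,\dots,i_m)$ of positive integers; $\ell(I)=m$, $|I|=\sum i_j$, $\bar I=(i_m,\dots,i_1)$. For a sequence $w=\{w_k\}$, $w^I=w_{i_1}\cdots w_{i_m}$. $fp(I)=i_1$, $\pi_u(I)=\prod_{j=1}^m(i_1+\cdots+i_j)$. $J\succeq I$ means $J$ is a refinement of $I$: $J$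 is the concatenation $J_1\cdot J_2\cdots J_m$ of compositions $J_a$ with $|J_a|=i_a$; then $\pi_u(J,I)=\prod_a\pi_u(J_a)$, $fp(J,I)=\prod_afp(J_a)$. *)

(* Defs.v *)
From HB Require Import structures.
From mathcomp Require Import all_boot all_order all_algebra.
From mathcomp.multinomials Require Import monalg.

Set Implicit Arguments.
Unset Strict Implicit.
Unset Printing Implicit Defensive.

Import GRing.Theory.
Local Open Scope ring_scope.

(* Formal power series f(t) = \sum_(n >= 0) t^n (f n), with t central,
   represented by their sequences of coefficients. *)
Section Fps.
Variable A : nzRingType.
Implicit Types f g h : nat -> A.

Definition fps_one : nat -> A := fun n => (n == 0%N)%:R.

Definition fps_mul f g : nat -> A :=
  fun n => \sum_(i < n.+1) f i * g (n - i)%N.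

(* d f(t) / dt *)
Definition fps_deriv f : nat -> A := fun n => f n.+1 *+ n.+1.

(* f(-t) *)
Definition fps_oppvar f : nat -> A := fun n => (-1) ^+ n * f n.

Lemma eq_fps_mul f f' g g' :
  f =1 f' -> g =1 g' -> fps_mul f g =1 fps_mul f' g'.
Proof. by move=> ef eg n; apply: eq_bigr => i _; rewrite ef eg. Qed.

Let trunc N f : {poly A} := \poly_(i < N) f i.

Let fps_mul_trunc N f g n : (n < N)%N ->
  fps_mul f g n = (trunc N f * trunc N g)`_n.
Proof.
move=> ltnN; rewrite coefM; apply: eq_bigr => i _; rewrite !coef_poly.
by rewrite (leq_ltn_trans (leq_subr i n) ltnN) (leq_trans (ltn_ord i) ltnN).
Qed.

Lemma fps_mulA f g h :
  fps_mul f (fps_mul g h) =1 fps_mul (fps_mul f g) h.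
Proof.
move=> n; set F := trunc n.+1 f; set G := trunc n.+1 g; set H := trunc n.+1 h.
have -> : fps_mul f (fps_mul g h) n = (F * (G * H))`_n.
  rewrite coefM; apply: eq_bigr => i _; rewrite coef_poly ltn_ord.
  by rewrite (@fps_mul_trunc n.+1) // ltnS leq_subr.
rewrite mulrA coefM; apply: eq_bigr => i _.
by rewrite (@fps_mul_trunc n.+1) // coef_poly ltnS leq_subr.
Qed.

Lemma fps_mul1 f : fps_mul f fps_one =1 f.
Proof.
move=> n; rewrite /fps_mul big_ord_recr /= subnn /fps_one eqxx mulr1.
by rewrite big1 ?add0r // => i _; rewrite subn_eq0 leqNgt ltn_ord mulr0.
Qed.

Lemma fps_1mul f : fps_mul fps_one f =1 f.
Proof.
move=> n; rewrite /fps_mul big_ord_recl /= subn0 /fps_one mul1r.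
by rewrite big1 ?addr0 // => i _; rewrite mul0r.
Qed.

Let rinv_seq f n : seq A :=
  iter n (fun s => rcons s ((size s == 0%N)%:R -
            \sum_(i < size s) f i.+1 * s`_(size s - i.+1))) [::].

Let size_rinv f n : size (rinv_seq f n) = n.
Proof. by elim: n => //= n IHn; rewrite size_rcons IHn. Qed.

Let nth_rinv f m n : (n < m)%N -> (rinv_seq f m)`_n = (rinv_seq f n.+1)`_n.
Proof.
elim: m => // m IHm; rewrite ltnS leq_eqVlt => /orP[/eqP-> // | ltnm].
by rewrite /= nth_rcons size_rinv ltnm IHm.
Qed.

Lemma fps_rinv f : f 0%N = 1 -> exists g, fps_mul f g =1 fps_one.
Proof.
move=> f0; exists (fun n => (rinv_seq f n.+1)`_n) => n.
rewrite /fps_mul big_ord_recl f0 mul1r subn0 /= nth_rcons size_rinv ltnn eqxx.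
rewrite -[RHS](subrK (\sum_(i < n) f i.+1 * (rinv_seq f n)`_(n - i.+1))).
congr (_ + _); apply: eq_bigr => i _; rewrite /bump /= add1n.
have lt_ni : (n - i.+1 < n)%N by rewrite ltn_subrL (leq_ltn_trans _ (ltn_ord i)).
by rewrite (nth_rinv f lt_ni).
Qed.

Lemma fps_inv f : f 0%N = 1 ->
  exists g, fps_mul f g =1 fps_one /\ fps_mul g f =1 fps_one.
Proof.
move=> f0; have [g fg] := fps_rinv f0.
have g0 : g 0%N = 1 
  by have := fg 0%N; rewrite /fps_mul big_ord1 f0 mul1r.
have [h gh] := fps_rinv g0; exists g; split=> // n.
have fh m : f m = h m.
  rewrite -[LHS]fps_mul1 -(eq_fps_mul (frefl f) gh) fps_mulA.
  by rewrite (eq_fps_mul fg (frefl h)) fps_1mul.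
by rewrite (eq_fps_mul (frefl g) fh) gh.
Qed.
End Fps.

(* Letter m : nat of the free monoid {fmonom nat} stands for the variable
   Lambda_(m.+1). *)
Notation NSym K := {malg K[{fmonom nat}]}.

(* A commutative Q-algebra K is a K : comAlgType rat. *)
Definition Lambda (K : comAlgType rat) (m : nat) : NSym K :=
  if m is k.+1 then << fmu k >> else 1.

(* The values Psi 0 and Xi 0 are unused: psi(t) and xi(t) have Psi n.+1 and
   Xi n.+1 as coefficients of t^n. *)
Definition defining_equations (K : comAlgType rat) (S Psi Xi : nat -> NSym K) :=
  let lambda_opp := fps_oppvar (@Lambda K) in
  let sigma := S in
  let psi n := Psi n.+1 in
  let xi n := Xi n.+1 in
  [/\ fps_mul lambda_opp sigma =1 @fps_one (NSym K),
      fps_mul sigma lambda_opp =1 @fps_one (NSym K),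
      fps_deriv sigma =1 fps_mul sigma psi &
      fps_deriv sigma =1 fps_mul xi sigma].

Lemma defining_equations_exist (K : comAlgType rat) :
  exists S Psi Xi : nat -> NSym K, defining_equations S Psi Xi.
Proof.
have l0 : fps_oppvar (@Lambda K) 0%N = 1 by rewrite /fps_oppvar mul1r.
have [S [lS Sl]] := fps_inv l0; set l := fps_oppvar _ in lS Sl.
exists S, (fun n => fps_mul l (fps_deriv S) n.-1),
  (fun n => fps_mul (fps_deriv S) l n.-1); split=> // n.
  by rewrite fps_mulA (eq_fps_mul Sl (frefl _)) fps_1mul.
by rewrite -fps_mulA (eq_fps_mul (frefl _) lS) fps_mul1.
Qed.

Lemma defining_equations_unique (K : comAlgType rat)
    (S Psi Xi S' Psi' Xi' : nat -> NSym K) :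
  defining_equations S Psi Xi -> defining_equations S' Psi' Xi' ->
  [/\ S =1 S', forall n, Psi n.+1 = Psi' n.+1 & forall n, Xi n.+1 = Xi' n.+1].
Proof.
move=> [lS Sl SPsi XiS] [lS' Sl' SPsi' XiS'].
set l := fps_oppvar _ in lS Sl lS' Sl'.
have eS : S =1 S'.
  move=> n; rewrite -[LHS]fps_mul1 -(eq_fps_mul (frefl S) lS') fps_mulA.
  by rewrite (eq_fps_mul Sl (frefl S')) fps_1mul.
have edS : fps_deriv S =1 fps_deriv S' by move=> n; rewrite /fps_deriv eS.
split=> // n.
- rewrite -[LHS](fps_1mul (fun n => Psi n.+1)).
  rewrite -(eq_fps_mul lS (frefl _)) -fps_mulA -(eq_fps_mul (frefl l) SPsi).
  rewrite (eq_fps_mul (frefl l) edS) (eq_fps_mul (frefl l) SPsi') fps_mulA.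
  by rewrite (eq_fps_mul lS' (frefl _)) fps_1mul.
- rewrite -[LHS](fps_mul1 (fun n => Xi n.+1)).
  rewrite -(eq_fps_mul (frefl _) Sl) fps_mulA -(eq_fps_mul XiS (frefl l)).
  rewrite (eq_fps_mul edS (frefl l)) (eq_fps_mul XiS' (frefl l)) -fps_mulA.
  by rewrite (eq_fps_mul (frefl _) Sl') fps_mul1.
Qed.

(* w^I *)
Definition word (A : nzRingType) (w : nat -> A) (I : seq nat) : A :=
  \prod_(i <- I) w i.

(* |I| is sumn I, \ell(I) is size I and \bar I is rev I. *)
Definition is_comp (I : seq nat) : bool := (I != [::]) && (0%N \notin I).

Fixpoint comps (n : nat) : seq (seq nat) :=
  match n with
  | 0 => [::]
  | 1 => [:: [:: 1%N]]
  | m.+1 => [seq 1%N :: s | s <- comps m]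
            ++ [seq (head 0%N s).+1 :: behead s | s <- comps m]
  end.

Lemma compsSS n :
  comps n.+2 = [seq 1%N :: s | s <- comps n.+1]
               ++ [seq (head 0%N s).+1 :: behead s | s <- comps n.+1].
Proof. by []. Qed.

Lemma mem_comps n I : (I \in comps n) = is_comp I && (sumn I == n).
Proof.
elim: n I => [|n IHn] I.
  by case: I => [|[|i] I] //=; rewrite andbF.
case: n IHn => [_|n IHn].
  rewrite /comps inE; case: I => [|[|[|i]] [|[|j] I]] //=.
  - by rewrite andbC add1n eqSS addSn.
  - by rewrite andbC addSn eqSS addnS.
rewrite compsSS mem_cat.
apply/orP/idP => [[] /mapP[J] | ].
- rewrite IHn => /andP[/andP[J0 cJ] /eqP sJ] ->.
  by rewrite /is_comp inE /= cJ sJ add1n eqxx.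
- rewrite IHn => /andP[/andP[J0 cJ] /eqP sJ] ->.
  case: J J0 cJ sJ => //= j J _; rewrite /is_comp !inE negb_or => /andP[_ cJ].
  by move=> <-; rewrite /= addSn eqxx andbT.
case: I => [|[|[|i]] I] //=; rewrite /is_comp inE //= => /andP[cI].
- rewrite add1n eqSS => sI; left; apply/mapP; exists I => //.
  rewrite IHn sI /is_comp cI !andbT.
  by case: I sI {cI}.
- rewrite addSn eqSS => sI; right; apply/mapP; exists (i.+1 :: I) => //.
  by rewrite IHn /= sI /is_comp inE cI.
Qed.

Lemma comps_uniq n : uniq (comps n).
Proof.
elim: n => // -[|n] // IHn; rewrite compsSS cat_uniq.
have nz J : J \in comps n.+1 -> exists j J', J = j.+1 :: J'.
  by rewrite mem_comps; case: J => [|[|j] J] //; exists j, J.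
apply/and3P; split.
- by rewrite map_inj_uniq // => I J [].
- apply/hasPn => _ /mapP[J /nz[j [J' ->]] ->].
  by apply/negP => /mapP[J'' _ []].
- rewrite map_inj_in_uniq // => I J /nz[i [I' ->]] /nz[j [J' ->]].
  by move=> [-> ->].
Qed.

(* Greedy decomposition of J = J_1 ... J_m with |J_a| = i_a where
   I = (i_1, ..., i_m): J_a is the shortest prefix of what remains of J whose
   sum is at least i_a. It is the only one possible, see refinesP and
   blocks_unique below. *)
Fixpoint blocks (J I : seq nat) : seq (seq nat) :=
  if I is i :: I' then
    let k := find (fun k => (i <= sumn (take k J))%N) (iota 0 (size J).+1) in
    take k J :: blocks (drop k J) I'
  else [::].

Definition refines (J I : seq nat) : bool :=
  [&& all is_comp (blocks J I), flatten (blocks J I) == J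
    & map sumn (blocks J I) == I].

Lemma blocks_cons J i I :
  let k := find (fun k => (i <= sumn (take k J))%N) (iota 0 (size J).+1) in
  blocks J (i :: I) = take k J :: blocks (drop k J) I.
Proof. by []. Qed.

Lemma blocks_unique (Js : seq (seq nat)) :
  all is_comp Js -> blocks (flatten Js) (map sumn Js) = Js.
Proof.
elim: Js => // B Js IH /andP[cB cJs].
rewrite [map _ _]/= [flatten _]/= blocks_cons.
suff -> : find (fun k => (sumn B <= sumn (take k (B ++ flatten Js)))%N)
    (iota 0 (size (B ++ flatten Js)).+1) = size B.
  by rewrite take_size_cat // drop_size_cat // IH.
rewrite size_cat -addSn iotaD find_cat.
set p := fun k => _; have pB : p (size B) by rewrite /p take_size_cat.
have -> : has p (iota 0 (size B).+1).
  by apply/hasP; exists (size B) => //; rewrite mem_iota add0n ltnS leqnn.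
rewrite -[(size B).+1]addn1 iotaD find_cat /= add0n pB size_iota addn0.
rewrite ifN //; apply/hasPn => k; rewrite mem_iota add0n => /andP[_ ltkB].
rewrite /p take_cat ltkB -ltnNge -{2}(cat_take_drop k B) sumn_cat -ltn_subLR //.
rewrite subnn (drop_nth 0%N ltkB) /= ltn_addr // lt0n.
by case/andP: cB => _; apply: contraNneq => <-; rewrite mem_nth.
Qed.

Lemma refinesP (J I : seq nat) :
  reflect (exists Js : seq (seq nat),
             [/\ all is_comp Js, J = flatten Js & map sumn Js = I])
          (refines J I).
Proof.
apply: (iffP and3P) => [[cB /eqP fB /eqP sB] | [Js [cJs -> <-]]].
  by exists (blocks J I).
by rewrite blocks_unique.
Qed.

Definition fp (I : seq nat) : nat := head 0%N I.

Definition pi_u (I : seq nat) : nat :=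
  (\prod_(j < size I) sumn (take j.+1 I))%N.

(* pi_u(J, I) and fp(J, I), for J a refinement of I. *)
Definition pi_u_rel (J I : seq nat) : nat := (\prod_(B <- blocks J I) pi_u B)%N.
Definition fp_rel (J I : seq nat) : nat := (\prod_(B <- blocks J I) fp B)%N.

Definition c_coef (I L : seq nat) : rat :=
  \sum_(J <- comps (sumn I) | refines L J && refines J I)
    (-1) ^+ (size J - size I) * (fp_rel J I)%:R / (pi_u_rel L J)%:R.

(* Main.v *)
From HB Require Import structures.
Require Import Defs.
From mathcomp Require Import all_boot all_order all_algebra.
From mathcomp.multinomials Require Import monalg.

Set Implicit Arguments.
Unset Strict Implicit.
Unset Printing Implicit Defensive.

Import GRing.Theory.
Local Open Scope ring_scope.

Local Arguments comps : simpl never.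

(** Both formulas come from expanding twice, through the complete functions
    [S_n].  Put [f(J) = (-1)^(size J - 1) fp(J)].  The coefficients of
    [d sigma/dt = sigma psi] and [d sigma/dt = xi sigma] are recursions on [n]
    that remove the last part of a composition, and give
<<
      S_n  = \sum_(L composition of n) Psi^L / pi_u(L)      (S_sum_Psi)
      Xi_n = \sum_(J composition of n) f(J) S^J             (Xi_sum_S)
>>
    Such an expansion of every [w_n] in words of [v] multiplies out: choosing a
    composition of each part of [I] is choosing a refinement of [I], hence
    [w^I] is a sum over the refinements of [I], with the products of the
    coefficients of the blocks as coefficients ([word_expand]).  Therefore
    [Xi^I] is the sum over [J] refining [I] of
    [(-1)^(size J - size I) fp(J, I) S^J], and [S^J] the sum over [L] refining
    [J] of [Psi^L / pi_u(L, J)].  Exchanging the two sums, which uses that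
    refinement is transitive, gives [c_coef I L] as the coefficient of [Psi^L].

    The second formula is the first one in the converse ring: reversing
    products exchanges the two differential equations, hence [Psi] and [Xi],
    and turns the word of [I] into the word of [rev I].

    This argument only needs a ring receiving a morphism from the rationals,
    which is automatically central ([rat_central]).  In this generality the
    converse ring is another instance of the same statement. *)

(** * Refinements of compositions *)

Lemma is_comp_flatten (Bs : seq (seq nat)) :
  Bs != [::] -> all is_comp Bs -> is_comp (flatten Bs).
Proof.
case: Bs => // B Bs _ /= /andP[/andP[B0 zB] cBs].
rewrite /is_comp; apply/andP; split; first by case: B B0 {zB}.
rewrite mem_cat negb_or zB /=; apply/flattenP => -[C CBs].
by case/andP: (allP cBs C CBs) => _ /negbTE->.
Qed.

Lemma is_comp_sumn_gt0 (B : seq nat) : is_comp B -> (0 < sumn B)%N.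
Proof. by case: B => [|[|b] B]. Qed.

Lemma refines_comp (L I : seq nat) : is_comp I -> refines L I -> is_comp L.
Proof.
move=> cI /refinesP[Bs [cBs -> sBs]]; apply: is_comp_flatten => //.
by move: cI; rewrite -sBs; case: Bs {cBs sBs}.
Qed.

Lemma refines_sumn (L I : seq nat) : refines L I -> sumn L = sumn I.
Proof. by move=> /refinesP[Bs [_ -> <-]]; rewrite sumn_flatten. Qed.

Lemma refines_size (L I : seq nat) : refines L I -> (size I <= size L)%N.
Proof.
move=> /refinesP[Bs [cBs -> <-]]; rewrite size_map.
elim: Bs cBs => //= B Bs IH /andP[/andP[B0 _] cBs].
by rewrite size_cat -add1n leq_add ?IH // lt0n size_eq0.
Qed.

(** The parts of [J] are the sums of the blocks of [L] over [J], so the blocks of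
    [J] over [I] group these blocks; concatenating each group gives the blocks
    of [L] over [I]. The induction splits off the group of the first part of
    [I]. *)
Lemma refines_trans (J L I : seq nat) :
  refines L J -> refines J I -> refines L I.
Proof.
move=> /refinesP[Ls [cLs -> sLs]] /refinesP[Js [cJs eJ <-]]; apply/refinesP.
rewrite {J}eJ in sLs; elim: Js Ls cJs cLs sLs => [|B Js IH] Ls.
  by case: Ls => // _ _ _; exists [::].
move=> /= /andP[cB cJs] cLs sLs.
have [sz_le eB] : (size B <= size Ls)%N /\ map sumn (take (size B) Ls) = B.
  rewrite map_take sLs take_size_cat // -(size_map sumn Ls) sLs size_cat.
  by rewrite leq_addr.
move: cLs; rewrite -{1}(cat_take_drop (size B) Ls) all_cat => /andP[cL1 cL2].
have [|Bs [cBs fBs sBs]] := IH (drop (size B) Ls) cJs cL2.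
  by rewrite map_drop sLs drop_size_cat.
exists (flatten (take (size B) Ls) :: Bs); split=> /=.
- rewrite cBs andbT is_comp_flatten //.
  by move: cB; rewrite -{1}eB; case: (take _ _).
- by rewrite -fBs -flatten_cat cat_take_drop.
- by rewrite sBs sumn_flatten eB.
Qed.

Lemma is_comp_rev (I : seq nat) : is_comp (rev I) = is_comp I.
Proof. by rewrite /is_comp mem_rev -!size_eq0 size_rev. Qed.

Lemma refines_rev (L I : seq nat) : refines (rev L) (rev I) = refines L I.
Proof.
suff H M N : refines M N -> refines (rev M) (rev N).
  by apply/idP/idP => /H //; rewrite !revK.
move=> /refinesP[Bs [cBs -> <-]]; apply/refinesP; exists (rev (map rev Bs)).
split.
- rewrite all_rev all_map; apply: sub_all cBs => B /=.
  by rewrite is_comp_rev.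
- by rewrite rev_flatten.
- rewrite map_rev -map_comp; congr rev; apply/eq_map => B /=.
  by rewrite sumn_rev.
Qed.

Lemma perm_comps_rev (n : nat) : perm_eq (map rev (comps n)) (comps n).
Proof.
apply: uniq_perm; rewrite ?comps_uniq //.
  by rewrite map_inj_uniq ?comps_uniq //; apply: can_inj revK.
move=> I; apply/mapP/idP => [[J + ->]|cI].
  by rewrite !mem_comps is_comp_rev sumn_rev.
exists (rev I); last by rewrite revK.
by move: cI; rewrite !mem_comps is_comp_rev sumn_rev.
Qed.

(** The decompositions [J_1, ..., J_m] with [|J_a| = i_a]. For a composition
    [I] they correspond to the refinements of [I] through [flatten], and unlike
    these they form a product, over which sums distribute. *)
Definition block_lists (I : seq nat) : seq (seq (seq nat)) :=
  foldr (fun i Bss => [seq B :: Bs | B <- comps i, Bs <- Bss]) [:: [::]] I.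

Lemma mem_block_lists (I : seq nat) (Bs : seq (seq nat)) :
  (Bs \in block_lists I) = all is_comp Bs && (map sumn Bs == I).
Proof.
elim: I Bs => [|i I IH] [|B Bs] //=.
- by rewrite inE andbF.
- by apply/negbTE/allpairsP => -[[C Cs] []].
rewrite eqseq_cons; apply/allpairsP/idP => [[[C Cs] /= [+ + [-> ->]]]|].
  rewrite mem_comps IH => /andP[-> /eqP<-] /andP[-> /eqP<-].
  by rewrite !eqxx.
move=> /andP[/andP[cB cBs] /andP[sB sBs]]; exists (B, Bs); split=> //=.
  by rewrite mem_comps cB.
by rewrite IH cBs.
Qed.

Lemma block_lists_uniq (I : seq nat) : uniq (block_lists I).
Proof.
elim: I => // i I IH; apply: allpairs_uniq; rewrite ?comps_uniq //.
by move=> [B Bs] [C Cs] _ _ [-> ->].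
Qed.

(** [flatten] is injective on [block_lists I] because [blocks] recovers the
    blocks from their concatenation. The hypothesis on [I] matters for
    [I = [::]], which has one (empty) decomposition while [comps 0] is empty. *)
Lemma perm_refinements (I : seq nat) : is_comp I ->
  perm_eq [seq L <- comps (sumn I) | refines L I]
          (map flatten (block_lists I)).
Proof.
move=> cI; apply: uniq_perm; first by rewrite filter_uniq ?comps_uniq.
  rewrite map_inj_in_uniq ?block_lists_uniq // => Bs Cs.
  rewrite !mem_block_lists => /andP[cBs /eqP sBs] /andP[cCs /eqP sCs] eBC.
  by rewrite -(blocks_unique cBs) -(blocks_unique cCs) eBC sBs sCs.
move=> L; rewrite mem_filter mem_comps; apply/idP/mapP => [|[Bs + ->]].
  move=> /andP[/refinesP[Bs [cBs -> sBs]] _]; exists Bs => //.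
  by rewrite mem_block_lists cBs sBs /=.
rewrite mem_block_lists => /andP[cBs /eqP sBs].
have ref : refines (flatten Bs) I by apply/refinesP; exists Bs.
by rewrite ref (refines_comp cI ref) (refines_sumn ref) eqxx.
Qed.

(** Classifying compositions by their last part matches the convolutions in the
    two differential equations, in which the factors have degrees [k.+1] and
    [n - k]. *)
Lemma perm_comps_rcons (n : nat) :
  perm_eq (comps n.+1)
    ([:: n.+1] :: [seq rcons J (n - k)%N | k <- iota 0 n, J <- comps k.+1]).
Proof.
have memE J : (J \in [seq rcons J (n - k)%N | k <- iota 0 n, J <- comps k.+1])
    -> exists2 J', is_comp J' & exists2 i, (0 < i)%N &
       J = rcons J' i /\ (sumn J' + i = n.+1)%N.
  move=> /allpairsPdep[k [J' [+ + ->]]].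
  rewrite mem_iota add0n mem_comps /= => ltkn /andP[cJ' /eqP sJ'].
  exists J' => //; exists (n - k)%N; rewrite ?subn_gt0 //; split=> //.
  by rewrite sJ' addSn subnKC // ltnW.
apply: uniq_perm; rewrite ?comps_uniq //.
  rewrite cons_uniq; apply/andP; split.
    by apply/negP => /memE[[|x [|y J]] // _ [i _ []]].
  apply: allpairs_uniq_dep; rewrite ?iota_uniq //.
    by move=> k _; apply: comps_uniq.
  move=> _ _ /allpairsPdep[k [J [_ + ->]]] /allpairsPdep[l [J' [_ + ->]]].
  rewrite !mem_comps => /andP[_ /eqP sJ] /andP[_ /eqP sJ'].
  move=> /= /rcons_inj[eJ _]; subst J'.
  by move: sJ'; rewrite sJ => -[->].
move=> J; rewrite inE mem_comps; apply/idP/orP; last first.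
  case=> [/eqP->|/memE[J' /andP[_ cJ'] [i i0 [-> si]]]].
    by rewrite /is_comp !inE /= addn0 eqxx.
  rewrite sumn_rcons si eqxx andbT /is_comp -size_eq0 size_rcons mem_rcons inE.
  by rewrite negb_or cJ' andbT /= neq_ltn i0.
move=> /andP[cJ /eqP sJ]; case/lastP: J => // J i in cJ sJ *.
move: cJ sJ; rewrite sumn_rcons /is_comp mem_rcons inE negb_or.
rewrite (eq_sym 0%N) -lt0n => /and3P[_ i0 cJ]; case: (eqVneq J [::]) => [->|J0] sJ.
  by left; rewrite -sJ.
have: is_comp J by rewrite /is_comp J0.
move=> /[dup] {}cJ /is_comp_sumn_gt0 sJ0; right; apply/allpairsPdep.
exists (sumn J).-1, J; rewrite mem_iota add0n mem_comps cJ prednK // eqxx.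
have sJi : ((sumn J).-1 + i = n)%N by apply: succn_inj; rewrite -addSn prednK.
split=> //; first by rewrite /= -ltnS -sJ -addn1 leq_add2l.
by rewrite -sJi addKn.
Qed.

Lemma big_comps_rcons (A : nzRingType) (n : nat) (F : seq nat -> A) :
  \sum_(J <- comps n.+1) F J =
    F [:: n.+1] + \sum_(k < n) \sum_(J <- comps k.+1) F (rcons J (n - k)%N).
Proof.
rewrite (perm_big _ (perm_comps_rcons n)) big_cons /=; congr (_ + _).
rewrite big_allpairs_dep /=.
rewrite -(big_mkord xpredT
  (fun k => \sum_(J <- comps k.+1) F (rcons J (n - k)%N))).
by rewrite /index_iota subn0.
Qed.

Lemma pi_u_rcons (L : seq nat) (i : nat) :
  pi_u (rcons L i) = (pi_u L * sumn (rcons L i))%N.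
Proof.
rewrite /pi_u size_rcons big_ord_recr /= take_oversize ?size_rcons //.
congr (_ * _)%N; apply: eq_bigr => j _.
by rewrite -cats1 takel_cat.
Qed.

(** * Logarithmic derivatives in a ring over the rationals *)

Section RationalRing.
Variables (A : nzRingType) (phi : {rmorphism rat -> A}).

(** The image of an integer is a multiple of [1], hence central, and the inverse
    of a denominator commutes with all that the denominator commutes with. *)
Lemma rat_central (q : rat) (x : A) : phi q * x = x * phi q.
Proof.
have int_central (z : int) (y : A) : phi z%:~R * y = y * phi z%:~R.
  by rewrite rmorph_int; apply: commr_sym; apply: commr_int.
rewrite -[q]divq_num_den; set d := (denq q)%:~R.
have d0 : d != 0 by rewrite intr_eq0 denq_neq0.
have dV : phi d * phi d^-1 = 1 by rewrite -rmorphM mulfV // rmorph1.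
have Vd : phi d^-1 * phi d = 1 by rewrite -rmorphM mulVf // rmorph1.
have V_central y : phi d^-1 * y = y * phi d^-1.
  rewrite -[y in LHS]mulr1 -dV !mulrA -(mulrA _ y) -int_central.
  by rewrite !mulrA Vd mul1r.
by rewrite rmorphM -mulrA V_central mulrA int_central mulrA.
Qed.

Lemma word_rcons (w : nat -> A) (I : seq nat) (i : nat) :
  word w (rcons I i) = word w I * w i.
Proof. by rewrite /word -cats1 big_cat big_seq1. Qed.

(** The two halves of [word_expand]: distributivity, then moving the central
    coefficients of the blocks to the left. *)
Lemma prod_sum_blocks (I : seq nat) (f : seq nat -> A) :
  \prod_(i <- I) \sum_(B <- comps i) f B =
    \sum_(Bs <- block_lists I) \prod_(B <- Bs) f B.
Proof.
elim: I => [|i I IH]; first by rewrite big_nil big_seq1 big_nil.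
rewrite big_cons IH big_distrl /= big_allpairs_dep /=; apply: eq_bigr => B _.
by rewrite big_distrr /=; apply: eq_bigr => Bs _; rewrite big_cons.
Qed.

Lemma prod_word_flatten (v : nat -> A) (g : seq nat -> rat)
    (Bs : seq (seq nat)) :
  \prod_(B <- Bs) (phi (g B) * word v B) =
    phi (\prod_(B <- Bs) g B) * word v (flatten Bs).
Proof.
elim: Bs => [|B Bs IH]; first by rewrite /word !big_nil rmorph1 mulr1.
rewrite !big_cons IH rmorphM /word /= big_cat /= -!mulrA; congr (_ * _).
by rewrite !mulrA rat_central.
Qed.

(** Substituting in the word of [I] an expansion of each letter; the form in
    which both [Xi_sum_S] and [S_sum_Psi] are used. *)
Lemma word_expand (w v : nat -> A) (g : seq nat -> rat) (I : seq nat) :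
    (forall n, w n.+1 = \sum_(B <- comps n.+1) phi (g B) * word v B) ->
    is_comp I ->
  word w I = \sum_(L <- comps (sumn I) | refines L I)
               phi (\prod_(B <- blocks L I) g B) * word v L.
Proof.
move=> wE cI; rewrite -big_filter (perm_big _ (perm_refinements cI)) big_map /=.
transitivity (\prod_(i <- I) \sum_(B <- comps i) phi (g B) * word v B).
  rewrite /word; apply: eq_big_seq => -[|n] // I0.
  by case/andP: cI; rewrite I0.
rewrite prod_sum_blocks; apply: eq_big_seq => Bs.
rewrite mem_block_lists => /andP[cBs /eqP<-].
by rewrite blocks_unique // prod_word_flatten.
Qed.

Section LogDerivatives.
Variables S Psi Xi : nat -> A.
Hypothesis S0 : S 0%N = 1.
Hypothesis dS_Psi : fps_deriv S =1 fps_mul S (fun n => Psi n.+1).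
Hypothesis dS_Xi : fps_deriv S =1 fps_mul (fun n => Xi n.+1) S.

(** Comparing coefficients of [t^n] in the first equation gives
    [n.+1 S_(n.+1)] as the sum of the [S_k Psi_(n.+1-k)] with [k <= n];
    the division by [n.+1 = |L|] at each step builds up [pi_u L], the product of
    the partial sums of [L]. *)
Lemma S_sum_Psi (n : nat) :
  S n.+1 = \sum_(L <- comps n.+1) phi (pi_u L)%:R^-1 * word Psi L.
Proof.
elim/ltn_ind: n => n IH.
have n0 : n.+1%:R != 0 :> rat by rewrite Num.Theory.pnatr_eq0.
have -> : S n.+1 = phi n.+1%:R^-1 * fps_mul S (fun n => Psi n.+1) n.
  rewrite -dS_Psi /fps_deriv -[S _ *+ _]mulr_natl -(rmorph_nat phi) mulrA.
  by rewrite -rmorphM mulVf // rmorph1 mul1r.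
rewrite big_comps_rcons /fps_mul big_ord_recl mulrDr; congr (_ + _).
  by rewrite S0 mul1r subn0 /word big_seq1 /pi_u big_ord1 /= addn0.
rewrite mulr_sumr; apply: eq_bigr => k _; rewrite lift0.
rewrite IH // mulr_suml mulr_sumr; apply: eq_big_seq => L.
rewrite mem_comps => /andP[_ /eqP sL].
rewrite pi_u_rcons sumn_rcons sL addSn subnKC ?(ltnW (ltn_ord k)) //.
by rewrite subnSK // word_rcons natrM invfM mulrC rmorphM -!mulrA.
Qed.

(** Solving the second equation for [Xi_(n.+1)] gives
    [n.+1 S_(n.+1)] minus the sum of the [Xi_k S_(n.+1-k)] with [1 <= k <= n],
    so that appending a part to [J] changes the sign and keeps [fp J]. *)
Lemma Xi_sum_S (n : nat) :
  Xi n.+1 = \sum_(J <- comps n.+1)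
              phi ((-1) ^+ (size J).-1 * (fp J)%:R) * word S J.
Proof.
elim/ltn_ind: n => n IH; rewrite big_comps_rcons.
rewrite expr0 mul1r rmorph_nat mulr_natl /word big_seq1.
have := dS_Xi n; rewrite /fps_deriv /fps_mul big_ord_recr /= subnn S0 mulr1.
move=> ->; rewrite addrAC -big_split big1 /= ?add0r // => k _.
rewrite IH // mulr_suml -big_split big1_seq // => J /andP[_].
rewrite mem_comps => /andP[/andP[J0 _] _].
rewrite -/(word S _) word_rcons mulrA.
have -> : fp (rcons J (n - k)%N) = fp J by case: J J0.
rewrite size_rcons -(prednK (n := size J)) ?lt0n ?size_eq0 // exprS -mulrA.
by rewrite mulN1r mulNr rmorphN !mulNr -mulrA /= subrr.
Qed.

Lemma prod_coef_Xi_S (J I : seq nat) : refines J I ->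
  \prod_(B <- blocks J I) ((-1) ^+ (size B).-1 * (fp B)%:R) =
    (-1) ^+ (size J - size I) * (fp_rel J I)%:R :> rat.
Proof.
move=> /refinesP[Bs [cBs -> <-]]; rewrite /fp_rel blocks_unique // big_split /=.
rewrite natr_prod; congr (_ * _); rewrite size_map.
elim: Bs cBs => [|B Bs IH] /=; first by rewrite big_nil.
move=> /andP[/andP[B0 _] cBs]; rewrite big_cons IH // -exprD size_cat.
congr (_ ^+ _); rewrite addnBA; last first.
  by rewrite -(size_map sumn) refines_size //; apply/refinesP; exists Bs.
by rewrite -subn1 addnBAC ?lt0n ?size_eq0 // -subnDA add1n.
Qed.

Lemma prod_coef_S_Psi (L J : seq nat) :
  \prod_(B <- blocks L J) (pi_u B)%:R^-1 = (pi_u_rel L J)%:R^-1 :> rat.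
Proof. by rewrite prodfV natr_prod. Qed.

(** Substitution of the second expansion in the first one. The intermediate
    [J] is bound to lie between [I] and [L], whence the sum defining
    [c_coef I L]. *)
Lemma word_Xi_Psi (I : seq nat) : is_comp I ->
  word Xi I = \sum_(L <- comps (sumn I) | refines L I)
                phi (c_coef I L) * word Psi L.
Proof.
move=> cI; rewrite (word_expand Xi_sum_S cI).
transitivity (\sum_(J <- comps (sumn I) | refines J I)
  \sum_(L <- comps (sumn I) | refines L I && refines L J)
    phi ((-1) ^+ (size J - size I) * (fp_rel J I)%:R / (pi_u_rel L J)%:R)
      * word Psi L).
  (* By transitivity the condition refines L I may be added, which makes the
     range of L the same for all J. *)
  apply: eq_bigr => J rJI.
  rewrite (word_expand S_sum_Psi (refines_comp cI rJI)).
  rewrite (refines_sumn rJI) mulr_sumr prod_coef_Xi_S //.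
  apply: eq_big => [L|L rLJ].
    by rewrite andb_idl // => rLJ; apply: refines_trans rLJ rJI.
  by rewrite prod_coef_S_Psi [in RHS]rmorphM mulrA.
rewrite (exchange_big_dep (refines^~ I)) => [|J L _ /andP[]//] /=.
apply: eq_bigr => L rLI; rewrite /c_coef rmorph_sum mulr_suml.
by apply: eq_bigl => J; rewrite rLI /= andbC.
Qed.

End LogDerivatives.
End RationalRing.

(** * Reversing words and products *)

Lemma word_converse (A : nzRingType) (w : nat -> A) (I : seq nat) :
  word (A := A^c) w I = word w (rev I).
Proof. by rewrite /word rev_prodr. Qed.

Lemma fps_mul_converse (A : nzRingType) (f g : nat -> A) :
  fps_mul (A := A^c) f g =1 fps_mul g f.
Proof.
move=> n; rewrite /fps_mul (reindex_inj rev_ord_inj) /=; apply: eq_bigr => i _.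
by rewrite subSS subKn // -ltnS.
Qed.

Section ConverseMorphism.
Variables (A : nzRingType) (phi : {rmorphism rat -> A}).

(** A copy of [phi] with the converse ring as its codomain, to carry the ring
    morphism structure there: products of rationals may be reversed. *)
Definition converse_morphism : rat -> A^c := phi.

Fact converse_morphism_additive : zmod_morphism converse_morphism.
Proof. exact: (rmorphB phi). Qed.

Fact converse_morphism_multiplicative : monoid_morphism converse_morphism.
Proof.
split; first exact: (rmorph1 phi).
by move=> p q; rewrite mulrC; apply: (rmorphM phi).
Qed.

HB.instance Definition _ :=
  GRing.isZmodMorphism.Build rat A^c converse_morphism
    converse_morphism_additive.
HB.instance Definition _ :=
  GRing.isMonoidMorphism.Build rat A^c converse_morphism
    converse_morphism_multiplicative.

(** In the converse ring [Xi] satisfies the equation of [Psi] and conversely, so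
    [word_Xi_Psi] applies there with the two exchanged. *)
Lemma word_Psi_Xi (S Psi Xi : nat -> A) :
    S 0%N = 1 ->
    fps_deriv S =1 fps_mul S (fun n => Psi n.+1) ->
    fps_deriv S =1 fps_mul (fun n => Xi n.+1) S ->
  forall I : seq nat, is_comp I ->
  word Psi I = \sum_(L <- comps (sumn I) | refines L I)
                 phi (c_coef (rev I) (rev L)) * word Xi L.
Proof.
move=> S0 dS_Psi dS_Xi I cI; rewrite -[I in LHS]revK -word_converse.
rewrite (@word_Xi_Psi A^c converse_morphism S Xi Psi) ?is_comp_rev //;
  first last.
- by move=> n; rewrite fps_mul_converse -dS_Psi.
- by move=> n; rewrite fps_mul_converse -dS_Xi.
rewrite sumn_rev -(perm_big _ (perm_comps_rev _)) big_map.
apply: eq_big => [L|L _]; first by rewrite refines_rev.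
rewrite word_converse revK; exact: esym (rat_central _ _ _).
Qed.

End ConverseMorphism.

(** * Expansions in the noncommutative symmetric functions *)

Lemma defining_equations_S0 (K : comAlgType rat) (S Psi Xi : nat -> NSym K) :
  defining_equations S Psi Xi -> S 0%N = 1.
Proof. by case=> /(_ 0%N); rewrite /fps_mul big_ord1 /fps_oppvar !mul1r. Qed.

Theorem lemma4p1 (K : comAlgType rat) (S Psi Xi : nat -> NSym K)
    (hSPX : defining_equations S Psi Xi) (I : seq nat) (hI : is_comp I) :
  word Xi I =
    \sum_(L <- comps (sumn I) | refines L I)
      (c_coef I L)%:A%R *: word Psi L
  /\
  word Psi I =
    \sum_(L <- comps (sumn I) | refines L I)
      (c_coef (rev I) (rev L))%:A%R *: word Xi L.
Proof.
(* Scaling by an element of K is multiplication by its image in NSym K. *)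
pose phi : {rmorphism rat -> NSym K} := in_alg (NSym K) \o in_alg K.
have phiE q x : q%:A *: x = phi q * x by rewrite /= mulr_algl.
have S0 := defining_equations_S0 hSPX; case: hSPX => _ _ dS_Psi dS_Xi.
split.
- rewrite (word_Xi_Psi phi S0 dS_Psi dS_Xi hI); apply: eq_bigr => L _.
  by rewrite phiE.
- rewrite (word_Psi_Xi phi S0 dS_Psi dS_Xi hI); apply: eq_bigr => L _.
  by rewrite phiE.
Qed.
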